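(* Let $A\colon\mathcal{X}\to 2^{\mathcal{X}^*}$, let $\varnothing\neq\mathcal{D}\subset\mathcal{X}$, let $W\colon\mathcal{D}\to\mathcal{X}^*$, let $x\in\mathcal{D}$, let $u^*\in\mathcal{X}^*$, and let $\gamma\in\,]0,+\infty[$. Suppose that $\mathcal{D}\cap\operatorname{dom}A\neq\varnothing$ and that one of the following properties (E1)--(E9) is satisfied: (E1) $Wx+\gamma u^*\in\operatorname{ran}(W+\gamma A)$. (E2) $W+\gamma A$ is surjective. (E3) $W+\gamma A$ is maximally monotone and $(W+\gamma A)^{-1}$ is locally bounded at every point in $\mathcal{X}^*$. (E4) $W+\gamma A$ is maximally monotone and either (a) $\operatorname{dom}W\cap\operatorname{dom}A$ is bounded, or (b) $\operatorname{dom}W\cap\operatorname{dom}A$ is unbounded and $\inf_{y^*\in Wy+\gamma Ay}\|y^*\|\to+\infty$ as $\|y\|\to+\infty$ with $y\in\operatorname{dom}W\cap\operatorname{dom}A$. (E5) $W+\gamma A$ is maximally monotone and $\phi$-uniformly monotone with $\phi(t)/t\to+\infty$ as $t\to+\infty$. (E6) $W+\gamma A$ is maximally monotone and $\alpha$-strongly monotone for some $\alpha\in\,]0,+\infty[$. (E7) $W$ and $A$ are monotone, $W+\gamma A$ is maximally monotone, $\operatorname{ran}W+\gamma\operatorname{ran}A=\mathcal{X}^*$, and one of the following is satisfied: (a) $W$ and $A$ are $3^*$ monotone; (b) $W$ is $3^*$ monotone and $\operatorname{dom}A\subset\operatorname{dom}W$; (c) $A$ is $3^*$ monotone and $\operatorname{dom}W\subset\operatorname{dom}A$.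 (E8) $W=\partial f$ with $f\in\Gamma_0(\mathcal{X})$, $A$ is monotone, $\partial f+\gamma A$ is maximally monotone, $\operatorname{dom}\partial f^*+\gamma\operatorname{ran}A=\mathcal{X}^*$, and either $\operatorname{dom}A\subset\operatorname{dom}\partial f$ or $A$ is $3^*$ monotone. (E9) $W$ and $A$ are monotone, $W+\gamma A$ is maximally monotone, and either (a) $W$ is $3^*$ monotone and surjective, or (b) $A$ is $3^*$ monotone and surjective. Suppose also that one of the following is satisfied: (i) $W+\gamma A$ is injective. (ii) $W+\gamma A$ is strictly monotone. (iii) $W$ is uniformly monotone and $A$ is monotone. Then $J_{\gamma(A-u^* )}^Wx$ is a singleton and, setting $z=J_{\gamma(A-u^* )}^Wx$, $$H_A(x,u^* )\geq\frac{\langle x-z,Wx-Wz\rangle}{\gamma}.$$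
   Context: $\mathcal{X}\neq\{0\}$ is a reflexive real Banach space with topological dual $\mathcal{X}^*$, and $\langle\cdot,\cdot\rangle$ is the canonical duality pairing. For $A\colon\mathcal{X}\to 2^{\mathcal{X}^*}$: $\operatorname{gra}A=\{(x,x^* )\mid x^*\in Ax\}$, $\operatorname{dom}A=\{x\mid Ax\neq\varnothing\}$, $\operatorname{ran}A=\bigcup_xAx$, $A^{-1}x^*=\{x\mid x^*\in Ax\}$; images of sets and compositions are unions of images; $A$ is surjective if $\operatorname{ran}A=\mathcal{X}^*$. A map $W\colon\mathcal{D}\to\mathcal{X}^*$ is identified with the set-valued operator equal to $\{Wx\}$ for $x\in\mathcal{D}$ and $\varnothing$ otherwise, so $\operatorname{dom}W=\mathcal{D}$. The Haraux function is $H_A\colon\mathcal{X}\times\mathcal{X}^*\to[-\infty,+\infty]\colon(x,u^* )\mapsto\sup_{(y,y^* )\in\operatorname{gra}A}\langle x-y,y^*-u^*\rangle$, and $\operatorname{dom}H_A=\{H_A<+\infty\}$. $\gamma(A-u^* )$ is the operator $x\mapsto\{\gamma(x^*-u^* )\mid x^*\in Ax\}$. The warped resolvent of $A$ with kernel $K\colon\mathcal{X}\to2^{\mathcal{X}^*}$ is $J_A^K=(K+A)^{-1}\circ K$; a singleton value is identified with its element. $A$ is monotone if $\langle x-y,x^*-y^*\rangle\geq0$ for all $(x,x^* ),(y,y^* )\in\operatorname{gra}A$, strictly monotone if moreover the inequality is strict whenever $x\neq y$, and maximally monotone if, for every $(x,x^* )\in\mathcal{X}\times\mathcal{X}^*$,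 $(x,x^* )\in\operatorname{gra}A$ iff $\langle x-y,x^*-y^*\rangle\geq0$ for every $(y,y^* )\in\operatorname{gra}A$. $A$ is $\phi$-uniformly monotone, where $\phi\colon[0,+\infty[\,\to[0,+\infty]$ is increasing and vanishes only at $0$, if $\langle x-y,x^*-y^*\rangle\geq\phi(\|x-y\|)$ for all $(x,x^* ),(y,y^* )\in\operatorname{gra}A$; uniformly monotone means $\phi$-uniformly monotone for some such $\phi$; $\alpha$-strongly monotone ($\alpha>0$) is the case $\phi=\alpha|\cdot|^2$. $A$ is $3^*$ monotone if it is monotone and $\operatorname{dom}A\times\operatorname{ran}A\subset\operatorname{dom}H_A$. $A$ is injective if $Ax\cap Ay\neq\varnothing$ implies $x=y$. $\Gamma_0(\mathcal{X})$ is the class of proper lower semicontinuous convex functions from $\mathcal{X}$ to $]-\infty,+\infty]$; $\partial f$ denotes the subdifferential of $f$ and $f^*\colon x^*\mapsto\sup_{x\in\mathcal{X}}(\langle x,x^*\rangle-f(x))$ its conjugate. *)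

(* Defs.v *)
From HB Require Import structures.
From mathcomp Require Import all_boot all_order all_algebra.
From mathcomp Require Import all_classical all_reals all_analysis.

Set Implicit Arguments.
Unset Strict Implicit.
Unset Printing Implicit Defensive.

Import Order.TTheory GRing.Theory Num.Theory.
Import numFieldNormedType.Exports.

Local Open Scope classical_set_scope.
Local Open Scope ring_scope.

Section dual_space.
Context {R : realType} (X : normedModType R).

Definition dual_pred : {pred X -> R} :=
  mem [set f : X -> R | scalar f /\ continuous (f : X -> R^o)].

Record dual := Dual { dual_fun :> X -> R ; dual_funP : dual_fun \in dual_pred }.

HB.instance Definition _ := [isSub for dual_fun].
HB.instance Definition _ := [Choice of dual by <:].

Fact dual_submod_closed : submod_closed dual_pred.
Proof.
split.
  rewrite inE; split; first by move=> a x y /=; rewrite mulr0 addr0.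
  by move=> x; exact: cst_continuous.
move=> a f g; rewrite !inE => -[lf cf] [lg cg]; split.
  move=> b x y; have -> z : (a *: f + g) z = a * f z + g z by [].
  by rewrite lf lg /= !mulrDr addrACA mulrCA.
by move=> x; apply: cvgD; [apply: cvgZr; exact: cf | exact: cg].
Qed.

HB.instance Definition _ :=
  GRing.isSubmodClosed.Build _ _ dual_pred dual_submod_closed.
HB.instance Definition _ := [SubChoice_isSubLmodule of dual by <:].

Lemma dual_linear (f : dual) : scalar f.
Proof. by have := dual_funP f; rewrite inE => -[]. Qed.

Lemma dual_continuous (f : dual) : continuous (f : X -> R^o).
Proof. by have := dual_funP f; rewrite inE => -[]. Qed.

HB.instance Definition _ (f : dual) :=
  GRing.isLinear.Build R X R *%R (dual_fun f) (dual_linear f).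

Definition dual_norm (f : dual) : R :=
  sup [set `|f x| | x in [set x : X | `|x| <= 1]].

Fact dual_norm_has_sup (f : dual) :
  has_sup [set `|f x| | x in [set x : X | `|x| <= 1]].
Proof.
split; first by exists `|f 0|, 0 => //=; rewrite normr0 ler01.
have lf : linear (f : X -> R^o) := dual_linear f.
pose mf := GRing.isLinear.Build R X R^o *:%R f lf.
pose F : {linear X -> R^o} := HB.pack (f : X -> R^o) mf.
have /bounded_funP/(_ 1)[M hM] : bounded_near F (nbhs (0 : X)).
  by apply: continuous_linear_bounded; exact: dual_continuous.
by exists M => _ [x /= x1 <-]; exact: hM.
Qed.

Lemma dual_norm_ub (f : dual) (x : X) : `|x| <= 1 -> `|f x| <= dual_norm f.
Proof.
by move=> x1; apply: ub_le_sup; [case: (dual_norm_has_sup f)|exists x].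
Qed.

Lemma dual_norm_le (f : dual) (M : R) :
  (forall x, `|x| <= 1 -> `|f x| <= M) -> dual_norm f <= M.
Proof.
move=> fM; apply: ge_sup; first by case: (dual_norm_has_sup f).
by move=> _ [x /= x1 <-]; exact: fM.
Qed.

Fact dual_norm_ge0 (f : dual) : 0 <= dual_norm f.
Proof. by rewrite (le_trans _ (@dual_norm_ub f 0 _)) ?normr0 ?ler01. Qed.

Fact ler_dual_normD (f g : dual) :
  dual_norm (f + g) <= dual_norm f + dual_norm g.
Proof.
apply: dual_norm_le => x x1; rewrite (le_trans (ler_normD _ _))//.
by rewrite lerD// dual_norm_ub.
Qed.

Fact dual_norm_leZ (a : R) (f : dual) :
  dual_norm (a *: f) <= `|a| * dual_norm f.
Proof.
apply: dual_norm_le => x x1.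
by rewrite [_ x]/(a * f x) normrM ler_wpM2l// dual_norm_ub.
Qed.

Fact dual_normZ (a : R) (f : dual) : dual_norm (a *: f) = `|a| * dual_norm f.
Proof.
have [->|a0] := eqVneq a 0.
  apply/eqP; rewrite eq_le dual_norm_leZ normr0 mul0r; exact: dual_norm_ge0.
apply/eqP; rewrite eq_le dual_norm_leZ/=.
rewrite -ler_pdivlMl ?normr_gt0// -normfV.
by rewrite -{1}[f](scalerK a0) dual_norm_leZ.
Qed.

Fact dual_norm_eq0 (f : dual) : dual_norm f = 0 -> f = 0.
Proof.
move=> f0; apply/val_inj/funext => x /=.
have [->|x0] := eqVneq x 0; first by rewrite linear0.
apply/eqP; rewrite -normr_le0.
have : `|f (`|x|^-1 *: x)| <= 0.
  by rewrite -f0; apply: dual_norm_ub; rewrite normrZ normfV normr_id mulVf ?normr_eq0.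
by rewrite linearZ/= normrM pmulr_rle0// normr_gt0 invr_eq0 normr_eq0.
Qed.

HB.instance Definition _ := Lmodule_isNormed.Build R dual
  ler_dual_normD dual_normZ dual_norm_eq0.

End dual_space.

Definition pairing {R : realType} {X : normedModType R} (x : X) (u : dual X) : R :=
  u x.

(* Surjectivity of the canonical embedding of X into its bidual. *)
Definition reflexive_space {R : realType} (X : normedModType R) : Prop :=
  forall F : dual (dual X), exists x : X, forall u : dual X, F u = pairing x u.

Section set_valued.
Context {T U : Type}.
Implicit Type A : T -> set U.

Definition sv_gra A : set (T * U) := [set p | A p.1 p.2].

Definition sv_dom A : set T := [set x | A x !=set0].

Definition sv_ran A : set U := \bigcup_x A x.

Definition sv_inv A : U -> set T := fun u => [set x | A x u].

Definition sv_surjective A : Prop := sv_ran A = setT.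

Definition sv_injective A : Prop :=
  forall x y, A x `&` A y !=set0 -> x = y.

(* A map W on D as a set-valued operator: {W y} for y in D, empty elsewhere. *)
Definition sv_of {D : set T} (W : D -> U) : T -> set U :=
  fun y => [set W d | d in [set d : D | val d = y]].

End set_valued.

Definition sv_comp {S T U : Type} (B : T -> set U) (A : S -> set T) : S -> set U :=
  fun x => \bigcup_(y in A x) B y.

Section set_valued_arith.
Context {R : realType} {T : Type} {V : lmodType R}.
Implicit Types A B : T -> set V.

Definition sv_add A B : T -> set V :=
  fun x => [set u + v | u in A x & v in B x].

Definition sv_scale (c : R) A : T -> set V := fun x => [set c *: u | u in A x].

Definition sv_shift A (u : V) : T -> set V := fun x => [set v - u | v in A x].

(* The warped resolvent of A with kernel K, usually written J_A^K. *)
Definition warped_resolvent (K A : T -> set V) : T -> set T :=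
  sv_comp (sv_inv (sv_add K A)) K.

End set_valued_arith.

Definition locally_bounded_at {R : realType} {V : topologicalType}
    {X : normedModType R} (B : V -> set X) (v : V) : Prop :=
  exists2 N, nbhs v N & bounded_set (\bigcup_(w in N) B w).

Section monotonicity.
Context {R : realType} {X : normedModType R}.
Implicit Type A : X -> set (dual X).

Definition haraux A (x : X) (u : dual X) : \bar R :=
  ereal_sup [set (pairing (x - p.1) (p.2 - u))%:E | p in sv_gra A].

Definition sv_monotone A : Prop :=
  forall x u y v, A x u -> A y v -> 0 <= pairing (x - y) (u - v).

Definition strictly_monotone A : Prop :=
  sv_monotone A /\
  forall x u y v, A x u -> A y v -> x != y -> 0 < pairing (x - y) (u - v).

Definition maximally_monotone A : Prop :=
  forall x u, A x u <-> forall y v, A y v -> 0 <= pairing (x - y) (u - v).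

(* The modulus is a function on [0, +oo[; its values at negative reals are
   irrelevant. "Increasing" is understood in the wide sense. *)
Definition modulus (phi : R -> \bar R) : Prop :=
  [/\ forall t, 0 <= t -> (0 <= phi t)%E,
      forall s t, 0 <= s -> s <= t -> (phi s <= phi t)%E
    & forall t, 0 <= t -> (phi t = 0%E <-> t = 0)].

Definition phi_uniformly_monotone (phi : R -> \bar R) A : Prop :=
  modulus phi /\
  forall x u y v, A x u -> A y v ->
    (phi `|x - y|%R <= (pairing (x - y) (u - v))%:E)%E.

Definition uniformly_monotone A : Prop :=
  exists phi, phi_uniformly_monotone phi A.

Definition strongly_monotone (alpha : R) A : Prop :=
  0 < alpha /\
  phi_uniformly_monotone (fun t => (alpha * `|t| ^+ 2)%:E) A.

Definition three_star_monotone A : Prop :=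
  sv_monotone A /\
  forall x u, sv_dom A x -> sv_ran A u -> (haraux A x u < +oo)%E.

End monotonicity.

Section convex_analysis.
Context {R : realType} {X : normedModType R}.
Implicit Type f : X -> \bar R.

(* The library's convex_function is restricted to finite-valued functions. *)
Definition ereal_convex f : Prop :=
  forall x y (t : R), 0 < t < 1 ->
    (f (t *: x + (1 - t) *: y)%R <= t%:E * f x + (1 - t)%:E * f y)%E.

Definition Gamma0 f : Prop :=
  [/\ forall x, f x != -oo%E, exists x, f x != +oo%E,
      lower_semicontinuous f & ereal_convex f].

Definition subdifferential f : X -> set (dual X) :=
  fun x => [set u | forall y, ((pairing (y - x) u)%:E + f x <= f y)%E].

(* The subdifferential of [conjugate f] takes its values in the bidual, which
   is the primal space up to the canonical embedding under reflexivity. *)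
Definition conjugate f : dual X -> \bar R :=
  fun u => ereal_sup (range (fun x => ((pairing x u)%:E - f x)%E)).

End convex_analysis.

(* Main.v *)
From HB Require Import structures.
Require Import Defs.
From mathcomp Require Import all_boot all_order all_algebra.
From mathcomp Require Import all_classical all_reals all_analysis.
From mathcomp Require Import ring lra.

Set Implicit Arguments.
Unset Strict Implicit.
Unset Printing Implicit Defensive.

Import Order.TTheory GRing.Theory Num.Theory.
Import numFieldNormedType.Exports.

Local Open Scope classical_set_scope.
Local Open Scope ring_scope.

(** The points z of the warped resolvent at x are the solutions of the inclusion
    W x + gamma u \in M z with M = W + gamma A. Each of (i), (ii), (iii) makes M
    injective, so there is at most one; and if gamma a = W x + gamma u - W z with
    a \in A z, then the term of the Haraux supremum at (z, a) is exactly
    <x - z, W x - W z> / gamma. What remains is existence, that is, that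
    W x + gamma u lies in the range of M. In (E3)-(E9), M is maximally monotone,
    and it turns out to be surjective.

    Surjectivity rests on Rockafellar's theorem: in a reflexive space, the
    inclusion u \in M x + eps J (x - x0), J being the duality mapping, has a
    solution for every eps > 0 ([regularized_inclusion]). No renorming is used.
    After a change of variables, the claim is that M contains a pair (y, v) with
    |y| = |v| and <y, v> = - |v|^2. Maximality puts the Fitzpatrick function F
    of M above the pairing, hence above minus the function
    g (x, u) = (|x|^2 + |u|^2) / 2 on X * X^*. The Hahn-Banach theorem separates F
    from - g by a continuous affine function; reflexivity represents its linear
    part by a pair (v, y), and maximality puts (y, v) in M
    ([maximally_monotone_meets_opp_duality]).

    Letting eps tend to 0, a bound on the solutions is enough to solve
    u \in M x: a weak limit of them is a solution ([bounded_approximants_ran]).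
    The bound has two sources.
    - Starting the regularization at a point x0 with u0 \in M x0, monotonicity
      keeps eps J (x - x0) in the ball of radius |u - u0|, so it suffices that the
      inverse of M be bounded on a ball around u ([local_solvability]). This gives
      (E4), (E5), (E6), where M is coercive, and (E3), by continuation along the
      segment from u0 to any target.
    - If for every u the Haraux function of M is finite at some (y, u), then the
      solutions are weakly bounded, hence bounded by the Banach-Steinhaus theorem
      ([brezis_haraux_surjective]). Since Haraux functions of a sum are bounded by
      sums of Haraux functions, this gives (E7) and (E9). In (E8), the Haraux
      function of the subdifferential of f at (y, v) is at most
      f y + f^* v - <y, v>, so a point v of the domain of the subdifferential of
      f^* can play the role of a point of the range of W. *)

(** * Linear functionals below convex sets *)

Definition sublinear {R : realType} {V : lmodType R} (p : V -> R) : Prop :=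
  (forall x y, p (x + y) <= p x + p y) /\
  (forall t x, 0 < t -> p (t *: x) <= t * p x).

Lemma sublinearZ {R : realType} {V : lmodType R} (p : V -> R) t x :
  sublinear p -> 0 < t -> p (t *: x) = t * p x.
Proof.
move=> [_ pZ] t0; apply/eqP; rewrite eq_le pZ//= -ler_pdivlMl//.
have := pZ t^-1 (t *: x); rewrite invr_gt0 => /(_ t0).
by rewrite scalerA mulVf ?gt_eqF// scale1r.
Qed.

Lemma sublinear0 {R : realType} {V : lmodType R} (p : V -> R) :
  sublinear p -> p 0 = 0.
Proof.
move=> /(@sublinearZ _ _ p 2 0) /(_ ltac:(by [])); rewrite scaler0; lra.
Qed.

(** The function x |-> inf_(t >= 0) (p (x + t y) - t p y) is sublinear and below
    p. If p is minimal, both coincide, and t = 1 gives p (x + y) >= p x + p y. *)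
Lemma minimal_sublinear_linear {R : realType} {V : lmodType R} (p : V -> R) :
  sublinear p ->
  (forall q, sublinear q -> (forall x, q x <= p x) -> q = p) ->
  scalar p.
Proof.
move=> sp pmin; have p0 := sublinear0 sp; have [pD pZ] := sp.
have pN x : - p (- x) <= p x.
  by have := pD x (- x); rewrite subrr p0; lra.
pose S y x := [set p (x + t *: y) - t * p y | t in [set t | 0 <= t]].
have S0 y x : S y x !=set0 by exists (p (x + 0 *: y) - 0 * p y), 0 => /=.
have lbS y x : lbound (S y x) (- p (- x)).
  move=> _ [t /= t0 <-]; rewrite -subr_ge0.
  have [->|tn0] := eqVneq t 0; first by rewrite scale0r addr0; have := pN x; lra.
  rewrite -[t * p y](sublinearZ _ sp) ?lt_def ?tn0//.
  by have := pD (x + t *: y) (- x); rewrite addrAC subrr add0r; lra.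
have hS y x : has_inf (S y x) by split; [exact: S0 | exists (- p (- x))].
have Sle y x s : S y x s -> inf (S y x) <= s.
  by move=> h; apply: ge_inf => //; case: (hS y x).
have pE y : (fun x => inf (S y x)) = p.
  apply: pmin => [|x]; last first.
    by apply: Sle; exists 0 => //=; rewrite scale0r addr0 mul0r subr0.
  split=> [x x'|c x c0].
    rewrite -lerBlDl; apply: lb_le_inf => // _ [t /= t0 <-].
    rewrite lerBlDl -lerBlDr; apply: lb_le_inf => // _ [s /= s0 <-].
    rewrite lerBlDr.
    apply: (@le_trans _ _ (p (x + x' + (s + t) *: y) - (s + t) * p y)).
      by apply: Sle; exists (s + t) => //=; exact: addr_ge0.
    by rewrite scalerDl addrACA; have := pD (x + s *: y) (x' + t *: y); lra.
  rewrite -ler_pdivrMl//; apply: lb_le_inf => // _ [t /= t0 <-].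
  rewrite ler_pdivrMl// mulrBr mulrA -(sublinearZ _ sp)// scalerDr scalerA.
  by apply: Sle; exists (c * t) => //=; rewrite mulr_ge0// ltW.
have padd x y : p (x + y) = p x + p y.
  apply/eqP; rewrite eq_le pD/= -lerBrDr -[in leLHS](pE y).
  by apply: Sle; exists 1 => //=; rewrite scale1r mul1r.
have pNE x : p (- x) = - p x by have := padd x (- x); rewrite subrr p0; lra.
move=> a x y; rewrite padd; congr (_ + _).
have [a0|a0|->] := ltgtP a 0; last by rewrite scale0r mul0r.
- rewrite -[a]opprK scaleNr pNE (sublinearZ _ sp) ?oppr_gt0//; lra.
- exact: sublinearZ.
Qed.

(** Hahn-Banach theorem by Zorn's lemma on sublinear functions rather than on
    partially defined functionals: pointwise infima of chains are sublinear, and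
    minimal elements are linear. *)
Lemma sublinear_above_linear {R : realType} {V : lmodType R} (p : V -> R) :
  sublinear p -> exists2 l : V -> R, scalar l & forall x, l x <= p x.
Proof.
move=> sp; pose T := {q : V -> R | sublinear q /\ forall x, q x <= p x}.
pose mk q (sq : sublinear q) (qp : forall x, q x <= p x) : T :=
  exist _ q (conj sq qp).
pose Q (q q' : T) := `[< forall x, sval q' x <= sval q x >].
have [||||[m [sm mp]] mmin] := @Zorn T Q.
- by move=> q; apply/asboolP.
- move=> q1 q2 q3 /asboolP h1 /asboolP h2; apply/asboolP => x.
  exact: le_trans (h2 x) (h1 x).
- move=> [q1 h1] [q2 h2] /asboolP/= h12 /asboolP/= h21.
  by apply/eq_exist/funext => x; apply/eqP; rewrite eq_le h12 h21.
- move=> C Ctot; have [[c Cc]|C0] := pselect (C !=set0); last first.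
    by exists (mk p sp (fun x => lexx _)) => s Cs; case: C0; exists s.
  pose S x := [set sval q x | q in C].
  have S0 x : S x !=set0 by exists (sval c x), c.
  have lbS x : lbound (S x) (- p (- x)).
    move=> _ [[q [sq qp]] /= _ <-]; have := qp (- x).
    by have := sq.1 x (- x); rewrite subrr (sublinear0 sq); lra.
  have Sle q x : C q -> inf (S x) <= sval q x.
    by move=> h; apply: ge_inf; [exists (- p (- x)) | exists q].
  have sS : sublinear (fun x => inf (S x)).
    split=> [x y|t x t0].
      rewrite -lerBlDl; apply: lb_le_inf => // _ [q Cq <-].
      rewrite lerBlDl -lerBlDr; apply: lb_le_inf => // _ [q' Cq' <-].
      rewrite lerBlDr; have [/asboolP h|/asboolP h] := Ctot _ _ Cq Cq'.
        apply: (le_trans (Sle q' _ Cq')); apply: le_trans (lerD (lexx _) (h y)).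
        exact: (svalP q').1.1.
      apply: (le_trans (Sle q _ Cq)); apply: le_trans (lerD (h x) (lexx _)).
      exact: (svalP q).1.1.
    rewrite -ler_pdivrMl//; apply: lb_le_inf => // _ [q Cq <-].
    rewrite ler_pdivrMl//; apply: (le_trans (Sle q _ Cq)).
    exact: (svalP q).1.2.
  have Sp x : inf (S x) <= p x.
    by apply: (le_trans (Sle c _ Cc)); exact: (svalP c).2.
  by exists (mk _ sS Sp) => q Cq; apply/asboolP => x /=; exact: Sle.
exists m => //; apply: (minimal_sublinear_linear sm) => q sq qm.
have qp x : q x <= p x := le_trans (qm x) (mp x).
by have /(congr1 sval) := mmin (mk q sq qp) (asboolT qm).
Qed.

(** Geometric form of the Hahn-Banach theorem, stated for a convex subset S of
    V * R that projects onto V and lies in the upper half-line over 0. Working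
    with a set instead of the graph of a convex function avoids taking infima
    in the applications. The infimum of s / k over (k v, s) in S and k > 0 is the
    greatest sublinear function below S. *)
Lemma hahn_banach {R : realType} {V : lmodType R} (S : V -> set R) :
  (forall v, S v !=set0) ->
  (forall v w s s' t, 0 < t < 1 -> S v s -> S w s' ->
     S (t *: v + (1 - t) *: w) (t * s + (1 - t) * s')) ->
  (forall s, S 0 s -> 0 <= s) ->
  exists2 l : V -> R, scalar l & forall v s, S v s -> l v <= s.
Proof.
move=> S0 Sconv S_ge0.
pose P v := [set a | exists2 k, 0 < k & S (k *: v) (k * a)].
(* The weights make both points scale to the common factor k h / (k + h). *)
have PD v w a b : P v a -> P w b -> P (v + w) (a + b).
  move=> [k k0 Sk] [h h0 Sh].
  have kh0 : 0 < k + h by rewrite addr_gt0.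
  exists (k * h / (k + h)); first by rewrite divr_gt0 ?mulr_gt0.
  have t01 : 0 < h / (k + h) < 1.
    by rewrite divr_gt0//= ltr_pdivrMr// mul1r ltrDr.
  have := Sconv _ _ _ _ _ t01 Sk Sh; rewrite !scalerA scalerDr.
  have -> : (1 - h / (k + h)) * h = k * h / (k + h) by field; rewrite gt_eqF.
  have -> : h / (k + h) * k = k * h / (k + h) by field; rewrite gt_eqF.
  congr (S _ _); field; by rewrite gt_eqF.
have PZ t v a : 0 < t -> P v a -> P (t *: v) (t * a).
  move=> t0 [k k0 Sk]; exists (k / t); first exact: divr_gt0.
  by rewrite scalerA mulrA divfK ?gt_eqF.
have P0 v : P v !=set0.
  have [s Ss] := S0 v; exists s, 1 => //; by rewrite scale1r mul1r.
have P_ge0 a : P 0 a -> 0 <= a.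
  by move=> [k k0]; rewrite scaler0 => /S_ge0; rewrite pmulr_rge0.
have Plb v : has_lbound (P v).
  have [b Pb] := P0 (- v); exists (- b) => a Pa.
  by have := PD _ _ _ _ Pa Pb; rewrite subrr => /P_ge0; lra.
have sp : sublinear (fun v => inf (P v)).
  split=> [v w|t v t0].
    rewrite -lerBlDl; apply: lb_le_inf => // b Pb.
    rewrite lerBlDl -lerBlDr; apply: lb_le_inf => // a Pa.
    by rewrite lerBlDr; apply: ge_inf => //; exact: PD.
  rewrite -ler_pdivrMl//; apply: lb_le_inf => // a Pa.
  by rewrite ler_pdivrMl//; apply: ge_inf => //; exact: PZ.
have [l ll lp] := sublinear_above_linear sp.
exists l => // v s Ss; apply: (le_trans (lp v)); apply: ge_inf => //.
by exists 1 => //; rewrite scale1r mul1r.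
Qed.

(** * The dual space *)

Lemma dual_apply_le {R : realType} {X : normedModType R} (f : dual X) (x : X) :
  `|f x| <= `|f| * `|x|.
Proof.
have [->|x0] := eqVneq x 0; first by rewrite linear0 !normr0 mulr0.
rewrite -ler_pdivrMr ?normr_gt0//.
have := @dual_norm_ub _ _ f (`|x|^-1 *: x).
rewrite normrZ normfV normr_id mulVf ?normr_eq0// => /(_ (lexx _)).
by rewrite linearZ/= normrM normfV normr_id mulrC.
Qed.

Lemma dual_of_scalar {R : realType} {X : normedModType R} (l : X -> R) (C : R) :
  scalar l -> (forall x, `|x| <= 1 -> l x <= C) ->
  exists2 f : dual X, (forall x, f x = l x) & `|f| <= C.
Proof.
move=> ll lC; have lf : linear (l : X -> R^o) := ll.
pose F : {linear X -> R^o} := HB.pack (l : X -> R^o)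
  (GRing.isLinear.Build R X R^o *:%R l lf).
have lC' x : `|x| <= 1 -> `|l x| <= C.
  move=> x1; rewrite ler_norml lC// andbT lerNl.
  have -> : - l x = l (- x) by rewrite -[l]/(F : X -> R) linearN.
  by apply: lC; rewrite normrN.
have Fc : continuous F.
  apply: bounded_linear_continuous; apply/ex_bound; exists C.
  apply/nbhs_normP; exists 1 => //= x /=; rewrite sub0r normrN => /ltW; exact: lC'.
have lP : (l : X -> R) \in @dual_pred R X by rewrite inE; split.
exists (Dual lP) => //.
exact: dual_norm_le.
Qed.

Lemma reflexive_rep {R : realType} {X : normedModType R} (l : dual X -> R) (C : R) :
  reflexive_space X -> scalar l -> (forall v, `|v| <= 1 -> l v <= C) ->
  exists x : X, forall v, l v = v x.
Proof.
move=> Xr ll /(dual_of_scalar ll)[F Fl _].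
by have [x Fx] := Xr F; exists x => v; rewrite -Fl Fx.
Qed.

(** A functional below v |-> |v + y| - |y| is below the norm, and its value at
    - y shows that it attains |y| at y. *)
Lemma norming_functional {R : realType} {X : normedModType R} (y : X) :
  exists2 f : dual X, `|f| <= 1 & f y = `|y|.
Proof.
have [v|v w s s' t /andP[t0 t1]|s|l ll lP] :=
  @hahn_banach R X (fun v => [set s | `|v + y| - `|y| <= s]).
- by exists (`|v + y| - `|y|); exact: lexx.
- move=> /= Ss Ss'; rewrite lerBlDr.
  have -> : t *: v + (1 - t) *: w + y = t *: (v + y) + (1 - t) *: (w + y).
    rewrite !scalerDr addrACA -scalerDl.
    by rewrite [t + _]addrC subrK scale1r.
  rewrite (le_trans (ler_normD _ _))// !normrZ !gtr0_norm ?subr_gt0//.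
  move: t0 t1 Ss Ss'; nra.
- by rewrite /= add0r subrr.
have l1 x : `|x| <= 1 -> l x <= 1.
  move=> x1; apply: lP => /=; have := ler_normD x y; lra.
have [f fl f1] := dual_of_scalar ll l1.
exists f => //; apply/eqP; rewrite eq_le; apply/andP; split.
  rewrite (le_trans (ler_norm _))// (le_trans (dual_apply_le _ _))//.
  by rewrite ler_piMl.
have := lP (- y) (- `|y|); rewrite /= addNr normr0 sub0r => /(_ (lexx _)).
by rewrite -fl linearN; lra.
Qed.

(** Completeness of the dual, required to apply Baire's theorem to it. The limit
    is pointwise; the Cauchy estimate passes to it uniformly on the unit ball. *)
Lemma dual_cauchy_cvg {R : realType} {X : normedModType R}
  (F : set_system (dual X)) : ProperFilter F -> cauchy F -> cvg F.
Proof.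
move=> FF /cauchy_ballP Fc.
have {}Fc e : 0 < e -> \forall f & g \near F, `|f - g| <= e.
  move=> e0; have := Fc e e0; apply: filterS => -[f g] /=.
  by rewrite -ball_normE /= => /ltW.
have ptw (x : X) : cvg ((fun f : dual X => f x : R^o) @ F).
  apply: (@cauchy_cvg R^o); apply/cauchy_ballP => e e0.
  rewrite near_map2.
  have x1 : 0 < `|x| + 1 by rewrite ltr_wpDl.
  have := Fc _ (divr_gt0 e0 x1).
  apply: filterS => -[f g] /= fg; rewrite -ball_normE /=.
  have -> : f x - g x = (f - g) x by [].
  rewrite (le_lt_trans (dual_apply_le _ _))//.
  rewrite (le_lt_trans (ler_wpM2r _ fg))// mulrAC ltr_pdivrMr//.
  by rewrite ltr_pM2l// ltrDl.
pose l x : R := lim ((fun f : dual X => f x : R^o) @ F).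
have ll : scalar l.
  move=> a x y; rewrite {1}/l; apply: (@cvg_lim R^o) => //.
  have -> : (fun f : dual X => f (a *: x + y) : R^o) =
            (fun f : dual X => a * f x + f y).
    by apply/funext => f; rewrite linearP.
  by apply: cvgD; [apply: cvgM; [exact: cvg_cst | exact: ptw] | exact: ptw].
have lim_le e : 0 < e ->
    \forall g \near F, forall x, `|x| <= 1 -> `|l x - (g : dual X) x| <= e.
  move=> e0; have /nearP_dep := Fc e e0.
  apply: filterS => g fg x x1; apply/ler_addgt0Pr => h h0.
  have fh : \forall f \near F, `|l x - (f : dual X) x| <= h.
    by have /cvgrPdist_le/(_ h h0) := ptw x.
  have [f [fgx fhx]] := filter_ex (filterI fg fh).
  have := ler_normD (l x - f x) (f x - g x); rewrite addrA subrK => /le_trans.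
  apply; rewrite addrC lerD//; have := dual_apply_le (g - f) x.
  rewrite -[(g - f) x]/(g x - f x) distrC => /le_trans; apply.
  by rewrite (le_trans (ler_wpM2l _ x1))// mulr1.
have [g0 g0P] := filter_ex (lim_le 1 ltr01).
have [|f0 f0l _] := @dual_of_scalar _ _ l (1 + `|g0|) ll.
  move=> x x1; have := g0P x x1; have := dual_apply_le g0 x.
  have := ler_norm (l x - g0 x); have := ler_norm (g0 x).
  have := ler_wpM2l (normr_ge0 g0) x1; lra.
apply/cvg_ex; exists f0; apply/cvgrPdist_le => e /lim_le.
apply: filterS => g gP; apply: dual_norm_le => x x1.
by rewrite -[(f0 - g) x]/(f0 x - g x) f0l; exact: gP.
Qed.

(** Banach-Steinhaus theorem for the evaluations at the points of Z, seen as
    functionals on the dual. *)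
Lemma uniform_boundedness {R : realType} {X : normedModType R} (Z : set X) :
  (forall v : dual X, exists C, forall z, Z z -> v z <= C) ->
  exists C, forall z, Z z -> `|z| <= C.
Proof.
move=> Zb.
pose Y : completeNormedModType R := HB.pack (dual X)
  (Uniform_isComplete.Build (dual X) (@dual_cauchy_cvg R X)).
pose ev (z : X) : Y -> R^o := fun v => (v : dual X) z.
have [|v|C CP] := @Banach_Steinhauss R Y R^o (ev @` Z) _ _ 1.
- move=> _ [z _ <-]; split; last by move=> a v w.
  move=> r; exists (r * `|z|) => v vr.
  by rewrite (le_trans (dual_apply_le v z))// ler_wpM2r.
- have [C1 C1P] := Zb v; have [C2 C2P] := Zb (- (v : dual X)).
  exists (Num.max C1 C2) => _ [z Zz <-].
  have vN : (- (v : dual X)) z = - (v : dual X) z by [].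
  rewrite /ev ler_norml lerNl !le_max C1P//= andbT -vN C2P// orbT//.
exists C => z Zz; have [f f1 fz] := norming_functional z.
have := CP (ev z) (ex_intro2 _ _ z Zz erefl) f f1.
by rewrite /ev fz normr_id.
Qed.

(** * Maximally monotone operators and the duality mapping *)

Lemma dual_apply_ge {R : realType} {X : normedModType R} (f : dual X) (x : X) :
  - (`|f| * `|x|) <= f x.
Proof. by have := dual_apply_le f x; rewrite ler_norml => /andP[]. Qed.

Lemma dual_applyD {R : realType} {X : normedModType R} (u : dual X) (x y : X) :
  u (x + y) = u x + u y.
Proof. by rewrite linearD. Qed.

Lemma dual_applyB {R : realType} {X : normedModType R} (u : dual X) (x y : X) :
  u (x - y) = u x - u y.
Proof. by rewrite linearB. Qed.

Lemma dual_applyZ {R : realType} {X : normedModType R} a (u : dual X) (x : X) :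
  u (a *: x) = a * u x.
Proof. by rewrite linearZ. Qed.

Lemma dualB {R : realType} {X : normedModType R} (u v : dual X) (x : X) :
  (u - v) x = u x - v x.
Proof. by []. Qed.

Lemma dualD {R : realType} {X : normedModType R} (u v : dual X) (x : X) :
  (u + v) x = u x + v x.
Proof. by []. Qed.

Lemma dualZ {R : realType} {X : normedModType R} a (u : dual X) (x : X) :
  (a *: u) x = a * u x.
Proof. by []. Qed.

Lemma sqr_norm_convex {R : realType} {X : normedModType R} (x y : X) (t : R) :
  0 < t < 1 ->
  `|t *: x + (1 - t) *: y| ^+ 2 <= t * `|x| ^+ 2 + (1 - t) * `|y| ^+ 2.
Proof.
move=> /andP[t0 t1].
have h : `|t *: x + (1 - t) *: y| <= t * `|x| + (1 - t) * `|y|.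
  by rewrite (le_trans (ler_normD _ _))// !normrZ !gtr0_norm ?subr_gt0.
apply: (@le_trans _ _ ((t * `|x| + (1 - t) * `|y|) ^+ 2)).
  by rewrite ler_pXn2r// nnegrE// addr_ge0// mulr_ge0// ltW// subr_gt0.
rewrite -subr_ge0.
have -> : t * `|x| ^+ 2 + (1 - t) * `|y| ^+ 2 - (t * `|x| + (1 - t) * `|y|) ^+ 2
  = t * (1 - t) * (`|x| - `|y|) ^+ 2 by ring.
by rewrite mulr_ge0 ?sqr_ge0// mulr_ge0 ?subr_ge0// ltW.
Qed.

Lemma maximally_monotone_neq0 {R : realType} {X : normedModType R}
  (M : X -> set (dual X)) : maximally_monotone M -> exists y v, M y v.
Proof.
move=> Mm; apply: contrapT => noM; apply: (noM); exists 0, 0; apply/Mm => y v Myv.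
by case: noM; exists y, v.
Qed.

(** The Fitzpatrick function of a maximally monotone operator dominates the
    pairing: were it smaller at (x, u), then (x, u) would be strictly
    monotonically related to the whole graph, hence in the graph, and then to
    itself. *)
Lemma fitzpatrick_ge {R : realType} {X : normedModType R}
  (M : X -> set (dual X)) (x : X) (u : dual X) (r : R) :
  maximally_monotone M ->
  (forall y v, M y v -> v x + u y - v y <= r) -> u x <= r.
Proof.
move=> Mm Fr; rewrite leNgt; apply/negP => ru.
have Mxu : M x u.
  by apply/Mm => y v /Fr; rewrite /pairing dualB !dual_applyB; lra.
by have := Fr _ _ Mxu; lra.
Qed.

(** The graph of M meets that of - J. The functional l obtained from the
    Hahn-Banach theorem satisfies l (p - m) <= g p + <m> for all p in X * X^* and
    m in the graph of M, where <m> is the pairing of the components of m. Writing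
    - l as (x, u) |-> <x, v> + <y, u> and optimizing over p gives
    |y|^2 / 2 + |v|^2 / 2 <= <x, u> - <x, v> - <y, u> for (x, u) in the graph.
    This is <x - y, u - v> >= |y|^2 / 2 + |v|^2 / 2 + <y, v> >= 0, so that (y, v)
    is in the graph; then (x, u) = (y, v) gives the two equalities. *)
Lemma maximally_monotone_meets_opp_duality {R : realType} {X : normedModType R}
  (M : X -> set (dual X)) : reflexive_space X -> maximally_monotone M ->
  exists y v, [/\ M y v, `|y| = `|v| & v y = - `|v| ^+ 2].
Proof.
move=> Xr Mm; have [x0 [u0 M0]] := maximally_monotone_neq0 Mm.
pose g (p : X * dual X) := (`|p.1| ^+ 2 + `|p.2| ^+ 2) / 2.
pose E (p : X * dual X) r := forall y v, M y v -> v p.1 + p.2 y - v y <= r.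
(* E is the epigraph of the Fitzpatrick function; it is convex and contains
   every graph point with the value of the pairing there. *)
have EM x u : M x u -> E (x, u) (u x).
  move=> Mxu y v Myv /=.
  by have /Mm/(_ _ _ Myv) := Mxu; rewrite /pairing dualB !dual_applyB; lra.
have [p|p q s s' t t01|s|l ll lP] := @hahn_banach R (X * dual X)%type
  (fun p => [set s | exists a r, E a r /\ g (p + a) + r <= s]).
- exists (g (p + (x0, u0)) + u0 x0), (x0, u0), (u0 x0); split => //; exact: EM.
- move=> [a [r [Ea gr]]] [b [r' [Eb gr']]] /=.
  have /andP[t0 t1] := t01; have t1' : 0 < 1 - t by rewrite subr_gt0.
  exists (t *: a + (1 - t) *: b), (t * r + (1 - t) * r'); split.
    move=> y v Myv.
    suff : v (t *: a.1 + (1 - t) *: b.1) + (t * a.2 y + (1 - t) * b.2 y) - v y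
           <= t * r + (1 - t) * r' by [].
    rewrite dual_applyD !dual_applyZ.
    have := ler_wpM2l (ltW t0) (Ea y v Myv).
    have := ler_wpM2l (ltW t1') (Eb y v Myv); lra.
  have := sqr_norm_convex (p + a).1 (q + b).1 t01.
  have := sqr_norm_convex (p + a).2 (q + b).2 t01.
  have -> : t *: p + (1 - t) *: q + (t *: a + (1 - t) *: b) =
            t *: (p + a) + (1 - t) *: (q + b) by rewrite !scalerDr addrACA.
  have -> : g (t *: (p + a) + (1 - t) *: (q + b)) =
    (`|t *: (p + a).1 + (1 - t) *: (q + b).1| ^+ 2 +
     `|t *: (p + a).2 + (1 - t) *: (q + b).2| ^+ 2) / 2 by [].
  have := ler_wpM2l (ltW t0) gr; have := ler_wpM2l (ltW t1') gr'.
  rewrite /g; lra.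
- move=> [[a b] [r [Ea]]]; rewrite add0r /g /=.
  have := fitzpatrick_ge Mm Ea; rewrite /= => bar.
  have := dual_apply_ge b a; have := sqr_ge0 (`|a| - `|b|); nra.
have lM w z x u : M x u -> l (w - x, z - u) <= (`|w| ^+ 2 + `|z| ^+ 2) / 2 + u x.
  move=> Mxu; apply: lP; exists (x, u), (u x); split; first exact: EM.
  by rewrite /g /= !subrK.
have l0 : l 0 = 0 by have := ll (-1) 0 0; rewrite scaleN1r oppr0 addr0; lra.
have lD p q : l (p + q) = l p + l q by have := ll 1 p q; rewrite scale1r mul1r.
have lZ a p : l (a *: p) = a * l p by have := ll a p 0; rewrite !addr0 l0 addr0.
have addp (a b : X) (c d : dual X) :
  (a, c) + (b, d) = (a + b, c + d) :> X * dual X by [].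
have scalep t (a : X) (c : dual X) :
  t *: (a, c) = (t *: a, t *: c) :> X * dual X by [].
have lpair w z : l (w, z) = l (w, 0) + l (0, z).
  by rewrite -lD addp addr0 add0r.
have l1 : scalar (fun w => - l (w, 0)).
  move=> a w w'; have -> : (a *: w + w', 0) = a *: (w, 0) + (w', 0) :> X * dual X.
    by rewrite !scalep addp scaler0 addr0.
  by rewrite lD lZ; ring.
have l2 : scalar (fun z => - l (0, z)).
  move=> a w w'; have -> : (0, a *: w + w') = a *: (0, w) + (0, w') :> X * dual X.
    by rewrite !scalep addp scaler0 addr0.
  by rewrite lD lZ; ring.
(* Local upper bounds for l make its two components continuous. *)
have lub w z : l (w, z) <=
    ((`|w| + `|x0|) ^+ 2 + (`|z| + `|u0|) ^+ 2) / 2 + u0 x0.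
  have := lM (w + x0) (z + u0) _ _ M0; rewrite !addrK => /le_trans; apply.
  rewrite lerD2r ler_pM2r// lerD// ler_pXn2r ?nnegrE ?addr_ge0//; exact: ler_normD.
have bnd (a b : R) : 0 <= a -> a <= 1 -> 0 <= b -> (a + b) ^+ 2 <= (1 + b) ^+ 2.
  by move=> a0 a1 b0; rewrite ler_pXn2r ?nnegrE ?addr_ge0// lerD2r.
pose C := ((1 + `|x0|) ^+ 2 + (1 + `|u0|) ^+ 2) / 2 + u0 x0.
have C1 (w : X) : `|w| <= 1 -> - l (w, 0) <= C.
  move=> w1; have := lub (- w) 0.
  have -> : (- w, 0) = -1 *: (w, 0) :> X * dual X.
    by rewrite scalep scaler0 scaleN1r.
  rewrite lZ mulN1r => /le_trans; apply; rewrite normrN normr0 /C.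
  have := bnd _ _ (normr_ge0 w) w1 (normr_ge0 x0).
  have := bnd 0 _ (lexx _) ler01 (normr_ge0 u0); lra.
have C2 (z : dual X) : `|z| <= 1 -> - l (0, z) <= C.
  move=> w1; have := lub 0 (- z).
  have -> : (0, - z) = -1 *: (0, z) :> X * dual X.
    by rewrite scalep scaler0 scaleN1r.
  rewrite lZ mulN1r => /le_trans; apply; rewrite normrN normr0 /C.
  have := bnd _ _ (normr_ge0 z) w1 (normr_ge0 u0).
  have := bnd 0 _ (lexx _) ler01 (normr_ge0 x0); lra.
have [v vE _] := dual_of_scalar l1 C1.
have [y yE] := reflexive_rep Xr l2 C2.
have key x u : M x u -> `|y| ^+ 2 + `|v| ^+ 2 <= 2 * (u x - v x - u y).
  move=> Mxu; have [f f1 fy] := norming_functional y.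
  set c := 2 * _.
  (* The point p = (- <a, v> a, - |y| f) is chosen so that, over multiples of a
     and f, the supremum of <p.1, - v> + <y, - p.2> - g p is attained when
     |a| = |f| = 1. *)
  have ineq a : `|a| <= 1 -> v a ^+ 2 <= c - `|y| ^+ 2.
    move=> a1; have := lM (- v a *: a) (- `|y| *: f) _ _ Mxu.
    have lE (w : X) (z : dual X) : l (w, z) = - v w - z y.
      by rewrite lpair vE -yE; ring.
    rewrite lE dualB dual_applyB dualZ dual_applyZ fy !normrZ !normrN normr_id.
    have h1 : (`|v a| * `|a|) ^+ 2 <= v a ^+ 2.
      rewrite exprMn real_normK ?num_real// ler_piMr ?sqr_ge0//.
      by rewrite expr_le1.
    have h2 : (`|y| * `|f|) ^+ 2 <= `|y| ^+ 2.
      by rewrite exprMn ler_piMr ?sqr_ge0// expr_le1.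
    rewrite /c; lra.
  have c0 : 0 <= c - `|y| ^+ 2.
    by have := ineq 0; rewrite normr0 linear0 expr0n; apply.
  have : `|v| <= Num.sqrt (c - `|y| ^+ 2).
    apply: dual_norm_le => a /ineq h.
    by rewrite -sqrtr_sqr ler_wsqrtr.
  rewrite -(@ler_pXn2r _ 2)// ?nnegrE ?sqrtr_ge0// sqr_sqrtr//; lra.
have vy := dual_apply_ge v y.
have Myv : M y v.
  apply/Mm => x u /key; rewrite /pairing dualB !dual_applyB.
  have := sqr_ge0 (`|y| - `|v|); nra.
have := key _ _ Myv; have := sqr_ge0 (`|y| - `|v|) => h1 h2.
have yv : `|y| = `|v|.
  apply/eqP; rewrite -subr_eq0 -sqrf_eq0; apply/eqP; nra.
exists y, v; split => //; rewrite yv in vy h2; nra.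
Qed.

(** * Solving inclusions by regularization *)

Lemma maximally_monotone_monotone {R : realType} {X : normedModType R}
  (M : X -> set (dual X)) : maximally_monotone M -> sv_monotone M.
Proof. by move=> Mm x u y v /Mm Mxu; exact: Mxu. Qed.

(** Rockafellar's theorem: j belongs to J (x - x0). After translation and
    scaling, [maximally_monotone_meets_opp_duality] applies to the operator
    y |-> (M (y + x0) - u) / eps. *)
Lemma regularized_inclusion {R : realType} {X : normedModType R}
  (M : X -> set (dual X)) (x0 : X) (u : dual X) (eps : R) :
  reflexive_space X -> maximally_monotone M -> 0 < eps ->
  exists x j, [/\ M x (u - eps *: j), `|x - x0| = `|j|
                & j (x - x0) = `|j| ^+ 2].
Proof.
move=> Xr Mm e0.
pose N y : set (dual X) := [set v | M (y + x0) (u + eps *: v)].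
have Nm : maximally_monotone N.
  have shift (y z : X) : y + x0 - (z + x0) = y - z.
    by rewrite opprD addrACA subrr addr0.
  have scale (v w : dual X) : u + eps *: v - (u + eps *: w) = eps *: (v - w).
    by rewrite opprD addrACA subrr add0r scalerBr.
  move=> y v; split.
    move=> /Mm h z w /h.
    by rewrite /pairing shift scale dualZ pmulr_rge0.
  move=> h; apply/Mm => z w Mzw.
  have zE : z = z - x0 + x0 by rewrite subrK.
  have wE : w = u + eps *: (eps^-1 *: (w - u)).
    by rewrite scalerA divff ?gt_eqF// scale1r [u + _]addrC subrK.
  rewrite zE wE /pairing shift scale dualZ pmulr_rge0//; apply: h.
  by rewrite /N /= -zE -wE.
have [y [v [Nyv yv vy]]] := maximally_monotone_meets_opp_duality Xr Nm.
exists (y + x0), (- v); rewrite scalerN opprK addrK normrN; split => //.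
by rewrite -[(- v) y]/(- (v y)) vy opprK.
Qed.

(** The graph of M is closed for bounded weak convergence in X and norm
    convergence in the dual. Instead of extracting a weak limit, a functional on
    the dual is taken below v |-> limsup <z, v> over the approximate solutions z;
    by reflexivity it is the evaluation at a point x, and the inequalities
    defining M pass to x. *)
Lemma bounded_approximants_ran {R : realType} {X : normedModType R}
  (M : X -> set (dual X)) (u : dual X) (C : R) :
  reflexive_space X -> maximally_monotone M ->
  (forall d, 0 < d -> exists z w, [/\ M z w, `|w - u| <= d & `|z| <= C]) ->
  sv_ran M u.
Proof.
move=> Xr Mm H.
pose Z d := [set z | exists w, [/\ M z w, `|w - u| <= d & `|z| <= C]].
have Z0 d : 0 < d -> exists z, Z d z.
  by move=> /H[z [w Zzw]]; exists z, w.
have ZC d z : Z d z -> `|z| <= C by move=> [w []].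
have ZS d e z : d <= e -> Z d z -> Z e z.
  by move=> de [w [Mzw wu zC]]; exists w; split => //; exact: le_trans de.
have C0 : 0 <= C by have [z /ZC] := Z0 1 ltr01; exact: le_trans.
have [v|v w s s' t /andP[t0 t1]|s|l ll lP] := @hahn_banach R (dual X)
  (fun v => [set s | exists2 d, 0 < d & forall z, Z d z -> v z <= s]).
- exists (`|v| * C), 1 => // z /ZC zC.
  rewrite (le_trans (ler_norm _))// (le_trans (dual_apply_le _ _))//.
  by rewrite ler_wpM2l.
- move=> [d d0 ds] [e e0 es']; exists (Num.min d e).
    by rewrite lt_min d0.
  move=> z Zz; rewrite dualD !dualZ lerD// ler_pM2l ?subr_gt0//.
    by apply: ds; apply: ZS Zz; rewrite ge_min lexx.
  by apply: es'; apply: ZS Zz; rewrite ge_min lexx orbT.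
- by move=> [d /Z0[z Zz] /(_ z Zz)].
have lC v : `|v| <= 1 -> l v <= C.
  move=> v1; apply: lP; exists 1 => // z /ZC zC.
  rewrite (le_trans (ler_norm _))// (le_trans (dual_apply_le _ _))//.
  by rewrite (le_trans (ler_wpM2r _ v1))// mul1r.
have [x lx] := reflexive_rep Xr ll lC.
exists x => //; apply/Mm => y v Myv.
rewrite /pairing dual_applyB !dualB.
suff : l (v - u) <= (v - u) y.
  by rewrite lx !dualB; lra.
apply/ler_addgt0Pr => h h0; apply: lP; have y0 : 0 < C + `|y| + 1.
  by rewrite ltr_wpDl// addr_ge0.
exists (h / (C + `|y| + 1)); first exact: divr_gt0.
move=> z [w [Mzw wu zC]].
have := maximally_monotone_monotone Mm Mzw Myv.
rewrite /pairing !dual_applyB !dualB => mono.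
have := dual_apply_le (w - u) (z - y); rewrite ler_norml => /andP[_].
have : `|w - u| * `|z - y| <= h.
  rewrite (le_trans (ler_wpM2r _ wu))// -mulrA ler_piMr ?(ltW h0)//.
  rewrite mulrC ler_pdivrMr// mul1r (le_trans (ler_normB _ _))//; lra.
rewrite dual_applyB !dualB; lra.
Qed.

(** Test the monotonicity of M between the regularized solution z and x0, the
    center of the regularization: eps |j|^2 <= <z - x0, u - u0>, so the residual
    eps j has norm at most |u - u0| whatever eps is. *)
Lemma local_solvability {R : realType} {X : normedModType R}
  (M : X -> set (dual X)) (x0 : X) (u0 u : dual X) (C : R) :
  reflexive_space X -> maximally_monotone M -> M x0 u0 ->
  (forall z w, M z w -> `|w - u| <= `|u0 - u| -> `|z| <= C) ->
  sv_ran M u.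
Proof.
move=> Xr Mm M0 H; apply: (@bounded_approximants_ran _ _ M u C) => // d d0.
have C0 : 0 <= C by have := H _ _ M0 (lexx _); exact: le_trans.
pose e := d / (C + `|x0| + 1).
have y0 : 0 < C + `|x0| + 1 by rewrite ltr_wpDl// addr_ge0.
have e0 : 0 < e by exact: divr_gt0.
have [z [j [Mz zj jz]]] := regularized_inclusion x0 u Xr Mm e0.
have wu : `|u - e *: j - u| = e * `|j|.
  by rewrite addrAC subrr sub0r normrN normrZ gtr0_norm.
have ej : e * `|j| <= `|u0 - u|.
  have := maximally_monotone_monotone Mm Mz M0.
  rewrite /pairing !dualB dualZ jz => mono.
  have := dual_apply_ge (u0 - u) (z - x0); rewrite dualB zj => h.
  have [->|jn0] := eqVneq `|j| 0; first by rewrite mulr0.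
  have jp : 0 < `|j| by rewrite lt_def jn0 /=.
  rewrite -(ler_pM2r jp); lra.
have zC : `|z| <= C by apply: H Mz _; rewrite wu.
exists z, (u - e *: j); split => //; rewrite wu -zj /e.
rewrite mulrAC ler_pdivrMr// ler_pM2l// (le_trans (ler_normB _ _))//; lra.
Qed.

(** * Surjectivity criteria *)

Lemma coercive_surjective {R : realType} {X : normedModType R}
  (M : X -> set (dual X)) :
  reflexive_space X -> maximally_monotone M ->
  (forall m, exists r, forall y v, M y v -> `|v| <= m -> `|y| <= r) ->
  sv_surjective M.
Proof.
move=> Xr Mm Mc; apply/seteqP; split=> // u _.
have [x0 [u0 M0]] := maximally_monotone_neq0 Mm.
have [C CP] := Mc (`|u| + `|u0 - u|).
apply: (local_solvability (C := C) Xr Mm M0) => z w Mzw wu.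
by apply: (CP z w Mzw); rewrite -lerBlDl (le_trans (lerB_dist _ _)).
Qed.

Lemma bounded_setP {R : realType} {X : normedModType R} (S : set X) :
  bounded_set S -> exists C, forall x, S x -> `|x| <= C.
Proof. by move=> [C [_ CP]]; exists (C + 1); apply: CP; rewrite ltrDl. Qed.

(** Continuation along c t = u0 + t (u - u0): let t be the supremum of the
    parameters in [0, 1] whose image is in the range. Around c t the inverse of
    M is bounded, so local solvability started close to c t reaches c t and
    slightly beyond, which forces t = 1. *)
Lemma locally_bounded_inv_surjective {R : realType} {X : normedModType R}
  (M : X -> set (dual X)) :
  reflexive_space X -> maximally_monotone M ->
  (forall v, locally_bounded_at (sv_inv M) v) -> sv_surjective M.
Proof.
move=> Xr Mm Mb; apply/seteqP; split=> // u _.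
have [x0 [u0 M0]] := maximally_monotone_neq0 Mm.
pose c t := u0 + t *: (u - u0).
have cB s t : `|c s - c t| = `|s - t| * `|u - u0|.
  by rewrite /c opprD addrACA subrr add0r -scalerBl normrZ.
pose T := [set t | t <= 1 /\ sv_ran M (c t)].
have T0 : T 0 by split => //; exists x0 => //; rewrite /c scale0r addr0.
have Tsup : has_sup T by split; [exists 0 | exists 1 => t []].
pose t := sup T.
have [N Nt /bounded_setP[C CP]] := Mb (c t).
have [r r0 rN] : exists2 r, 0 < r & forall w, `|w - c t| < r -> N w.
  have /nbhs_ballP[r /= r0 rN] := Nt; exists r => // w wr; apply: rN.
  by rewrite -ball_normE /= distrC.
(* Points at distance at most the double step from c h stay in the ball of
   radius r around c t: hence the factor 3. *)
pose e := r / (3 * (`|u - u0| + 1)).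
have d0 : 0 < `|u - u0| + 1 by rewrite ltr_wpDl.
have e0 : 0 < e by rewrite divr_gt0// mulr_gt0.
have er : 3 * (e * `|u - u0|) < r.
  have -> : r = 3 * (e * (`|u - u0| + 1)).
    by rewrite /e; field; rewrite gt_eqF.
  by rewrite ltr_pM2l// ltr_pM2l// ltrDl.
clearbody e.
have [s Ts st] := sup_adherent e0 Tsup; have [_ [x _ Mxs]] := Ts.
have {}st : `|s - t| <= e.
  have : s <= t by exact: (sup_upper_bound Tsup).
  by rewrite ler_norml; move: st; rewrite -/t; lra.
have near h : `|h - t| <= e -> sv_ran M (c h).
  move=> ht; apply: (local_solvability (C := C) Xr Mm Mxs) => z w Mzw wu.
  apply: CP; exists w => //; apply: rN.
  have d1 := normr_ge0 (u - u0).
  have h1 := ler_distD (c h) w (c t).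
  have h2 := ler_distD t s h.
  rewrite cB in h1; rewrite cB in wu.
  have h3 := ler_wpM2r d1 ht.
  have h4 : `|s - h| <= e + e by rewrite (le_trans h2)// lerD// distrC.
  have h5 := ler_wpM2r d1 h4.
  rewrite (le_lt_trans h1)// (le_lt_trans (lerD (le_trans wu h5) h3))//.
  have e3 : e + e + e = 3 * e by ring.
  by rewrite -mulrDl e3 -mulrA.
have t1 : t = 1.
  have t1 : t <= 1 by apply: ge_sup; [exists 0 | move=> a []].
  apply/eqP; rewrite eq_le t1 leNgt; apply/negP => tlt1.
  have : T (Num.min 1 (t + e)).
    split; first by rewrite ge_min lexx.
    apply: near; rewrite ler_norml; case: (leP 1 (t + e)); lra.
  move/(sup_upper_bound Tsup); rewrite -/t; case: (leP 1 (t + e)); lra.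
have := near 1; rewrite t1 subrr normr0 /c scale1r addrC subrK; apply; exact: ltW.
Qed.

(** The hypothesis at u + v bounds <z, v> from above for all solutions z of the
    regularized inclusions with eps <= 1 at once: the quadratic term
    - eps |z|^2 absorbs eps |y| |z|. As v is arbitrary, the solutions are bounded,
    and their residuals eps j, of norm eps |z|, tend to 0. *)
Lemma brezis_haraux_surjective {R : realType} {X : normedModType R}
  (M : X -> set (dual X)) :
  reflexive_space X -> maximally_monotone M ->
  (forall u, exists y K, forall z w, M z w -> pairing (y - z) (w - u) <= K) ->
  sv_surjective M.
Proof.
move=> Xr Mm H; apply/seteqP; split=> // u _.
pose Z := [set z | exists e j, [/\ 0 < e, e <= 1, M z (u - e *: j),
                                   `|z| = `|j| & j z = `|j| ^+ 2]].
have [v|C CP] := @uniform_boundedness R X Z.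
  have [y [K yK]] := H (u + v); exists (K + v y + `|y| ^+ 2).
  move=> z [e [j [e0 e1 Mz zj jz]]].
  have := yK _ _ Mz; rewrite /pairing.
  have -> : u - e *: j - (u + v) = - (e *: j) - v.
    by rewrite opprD addrACA subrr add0r.
  rewrite dual_applyB !dualB.
  have -> : (- (e *: j)) y = - (e * j y) by [].
  have -> : (- (e *: j)) z = - (e * j z) by [].
  rewrite jz => h.
  have jy : e * j y <= e * (`|j| * `|y|).
    by rewrite ler_pM2l// (le_trans (ler_norm _))// dual_apply_le.
  have sq : 0 <= e * (`|j| - `|y| / 2) ^+ 2 by rewrite mulr_ge0 ?sqr_ge0// ltW.
  have ey : e * `|y| ^+ 2 <= `|y| ^+ 2 by rewrite ler_piMl ?sqr_ge0.
  have := sqr_ge0 `|y|; lra.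
apply: (@bounded_approximants_ran _ _ M u C) => // d d0.
have C0 : 0 < `|C| + 1 by rewrite ltr_wpDl.
pose e := Num.min 1 (d / (`|C| + 1)).
have e0 : 0 < e by rewrite lt_min ltr01 divr_gt0.
have [z [j []]] := regularized_inclusion 0 u Xr Mm e0.
rewrite subr0 => Mz zj jz.
have zC : `|z| <= C.
  by apply: CP; exists e, j; split => //; rewrite ge_min lexx.
exists z, (u - e *: j); split => //.
rewrite addrAC subrr sub0r normrN normrZ gtr0_norm// -zj.
have ed : e * (`|C| + 1) <= d by rewrite -ler_pdivlMr// ge_min lexx orbT.
rewrite (le_trans _ ed)// ler_pM2l//; have := ler_norm C; lra.
Qed.

(** Compare with a fixed graph point (y0, v0), at distance t from y:
    phi t <= |v - v0| t, so phi t / t is bounded when v is. *)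
Lemma superlinear_coercive {R : realType} {X : normedModType R}
  (M : X -> set (dual X)) (phi : R -> \bar R) :
  maximally_monotone M -> phi_uniformly_monotone phi M ->
  (forall m : R, exists T : R, forall t, T < t -> (m%:E < phi t * (t^-1)%:E)%E) ->
  forall m, exists r, forall y v, M y v -> `|v| <= m -> `|y| <= r.
Proof.
move=> Mm [_ Mphi] grow m; have [y0 [v0 M0]] := maximally_monotone_neq0 Mm.
have [T TP] := grow (m + `|v0|).
exists (Num.max T 0 + `|y0|) => y v Myv vm; rewrite leNgt; apply/negP => big.
have : Num.max T 0 < `|y - y0| by rewrite (lt_le_trans _ (lerB_dist _ _))// ltrBrDr.
rewrite gt_max => /andP[/TP + t0]; apply/negP; rewrite -leNgt lee_pdivrMr//.
rewrite (le_trans (Mphi _ _ _ _ Myv M0))// -EFinM lee_fin /pairing.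
rewrite (le_trans (ler_norm _))// (le_trans (dual_apply_le _ _))//.
by rewrite ler_pM2r// (le_trans (ler_normB _ _))// lerD2r.
Qed.

Lemma strongly_monotone_superlinear {R : realType} (alpha : R) :
  0 < alpha -> forall m : R, exists T : R, forall t, T < t ->
  (m%:E < (alpha * `|t| ^+ 2)%:E * (t^-1)%:E)%E.
Proof.
move=> a0 m; exists (Num.max (m / alpha) 0) => t; rewrite gt_max => /andP[mt t0].
by rewrite -EFinM lte_fin gtr0_norm// expr2 mulrA mulfK ?gt_eqF// mulrC -ltr_pdivrMr.
Qed.

(** * Haraux functions *)

Lemma haraux_ltyP {R : realType} {X : normedModType R}
  (A : X -> set (dual X)) (y : X) (u : dual X) :
  (haraux A y u < +oo)%E <->
  exists K, forall z w, A z w -> pairing (y - z) (w - u) <= K.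
Proof.
split=> [Hoo|[K HK]]; last first.
  apply: (@le_lt_trans _ _ K%:E); last exact: ltry.
  by apply: ge_ereal_sup => _ [[z w] /= Azw <-]; rewrite lee_fin; exact: HK.
exists (fine (haraux A y u)) => z w Azw.
have H : ((pairing (y - z) (w - u))%:E <= haraux A y u)%E.
  by apply: ereal_sup_ubound; exists (z, w).
move: H Hoo; case: (haraux A y u) => [r| |] //=; by rewrite lee_fin.
Qed.

Lemma monotone_haraux_lty {R : realType} {X : normedModType R}
  (A : X -> set (dual X)) (y : X) (u : dual X) :
  sv_monotone A -> A y u -> (haraux A y u < +oo)%E.
Proof.
move=> Am Ayu; apply/haraux_ltyP; exists 0 => z w Azw.
by have := Am _ _ _ _ Azw Ayu; rewrite /pairing !dual_applyB !dualB; lra.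
Qed.

(** The Brezis-Haraux theorem in the form that the applications need: it is
    enough to bound the Haraux functions of B and A at a common point y, for
    some decomposition of u. *)
Lemma sum_surjective {R : realType} {X : normedModType R}
  (B A : X -> set (dual X)) (gamma : R) :
  reflexive_space X -> 0 < gamma ->
  maximally_monotone (sv_add B (sv_scale gamma A)) ->
  (forall u, exists y v w, [/\ u = v + gamma *: w, (haraux B y v < +oo)%E
                             & (haraux A y w < +oo)%E]) ->
  sv_surjective (sv_add B (sv_scale gamma A)).
Proof.
move=> Xr g0 Mm H; apply: brezis_haraux_surjective => // u.
have [y [v [w [-> /haraux_ltyP[K1 HK1] /haraux_ltyP[K2 HK2]]]]] := H u.
exists y, (K1 + gamma * K2) => z _ [b Bzb [_ [a Aza <-] <-]].
rewrite /pairing opprD addrACA -scalerBr dualD dualZ.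
by rewrite lerD ?ler_pM2l//; [exact: HK1|exact: HK2].
Qed.

Section subdifferential.
Context {R : realType} {X : normedModType R} (f : X -> \bar R).
Hypothesis f_gtNy : forall x, f x != -oo%E.
Hypothesis f_proper : exists x, f x != +oo%E.

Lemma subdifferential_dom_fin_num y : sv_dom (subdifferential f) y -> f y \is a fin_num.
Proof.
move=> [b bP]; have [t ft] := f_proper; rewrite fin_numE f_gtNy/=.
apply/eqP => fy; have := bP t; rewrite fy addey// leye_eq.
by rewrite (negbTE ft).
Qed.

(** A subgradient b of f at y makes f^* b finite, and if f^* v were infinite, a
    subgradient of f^* at v would make f^* infinite everywhere. *)
Lemma conjugate_fin_num v :
  sv_dom (subdifferential f) !=set0 ->
  sv_dom (subdifferential (conjugate f)) v -> conjugate f v \is a fin_num.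
Proof.
move=> [y domy] [F FP]; have fy := subdifferential_dom_fin_num domy.
have [b bP] := domy; rewrite fin_numE; apply/andP; split.
  rewrite -ltNye; apply: (@lt_le_trans _ _ ((pairing y v)%:E - f y)%E).
    by rewrite -(fineK fy) -EFinB ltNyr.
  by apply: ereal_sup_ubound; exists y.
apply/eqP => fv; have := FP b; rewrite fv addey// leye_eq => /eqP fb.
have : (conjugate f b <= (pairing y b)%:E - f y)%E.
  apply: ge_ereal_sup => _ [t _ <-]; have := bP t.
  rewrite -(fineK fy); case: (f t) (f_gtNy t) => [r| |]//= _; last first.
    by rewrite addeNy leNye.
  by rewrite -!EFinB -EFinD !lee_fin /pairing dual_applyB; lra.
rewrite fb -(fineK fy) -EFinB; by rewrite leye_eq.
Qed.

(** For b a subgradient of f at z, add <y - z, b> <= f y - f z and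
    <z, v> - f z <= f^* v; the values f z cancel. *)
Lemma subdifferential_haraux_lty y v :
  f y \is a fin_num -> conjugate f v \is a fin_num ->
  (haraux (subdifferential f) y v < +oo)%E.
Proof.
move=> fy fv; apply/haraux_ltyP; exists (fine (f y) + fine (conjugate f v) - v y).
move=> z b bP; have fz : f z \is a fin_num.
  by apply: subdifferential_dom_fin_num; exists b.
have h1 := bP y.
have h2 : ((pairing z v)%:E - f z <= conjugate f v)%E.
  by apply: ereal_sup_ubound; exists z.
move: h1 h2 fy fz fv; case: (f y) => // a; case: (f z) => // c.
case: (conjugate f v) => // d; rewrite -EFinB -EFinD !lee_fin /fine.
by rewrite /pairing !dual_applyB !dualB => h1 h2 _ _ _; lra.
Qed.

End subdifferential.

(** * The warped resolvent *)

Lemma strictly_monotone_injective {R : realType} {X : normedModType R}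
  (M : X -> set (dual X)) : strictly_monotone M -> sv_injective M.
Proof.
move=> [_ Ms] x y [u [Mx My]]; apply/eqP/negPn/negP => xy.
by have := Ms _ _ _ _ Mx My xy; rewrite /pairing subrr ltxx.
Qed.

(** If b + gamma a = b' + gamma a', then <x - y, b - b'> and
    gamma <x - y, a - a'> add up to 0; the second is nonnegative, so the modulus
    vanishes at |x - y|. *)
Lemma uniformly_monotone_sum_injective {R : realType} {X : normedModType R}
  (B A : X -> set (dual X)) (gamma : R) :
  0 < gamma -> uniformly_monotone B -> sv_monotone A ->
  sv_injective (sv_add B (sv_scale gamma A)).
Proof.
move=> g0 [phi [[phi_ge0 _ phi0] Bphi]] Am x y.
move=> [_ [[b Bb [_ [a Aa <-] <-]] [b' Bb' [_ [a' Aa' <-] eqm]]]].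
have h1 := Bphi _ _ _ _ Bb Bb'; have h2 := Am _ _ _ _ Aa Aa'.
have bb : b - b' = - (gamma *: (a - a')).
  by rewrite scalerBr opprB; apply/eqP; rewrite subr_eq addrAC -subr_eq opprK addrC -eqm addrC.
have phi_eq0 : phi `|x - y| = 0%E.
  apply/eqP; rewrite eq_le phi_ge0// andbT (le_trans h1)// lee_fin bb /pairing.
  by rewrite -scaleNr dualZ mulNr oppr_le0 mulr_ge0// ltW.
by have /phi0/eqP := phi_eq0; rewrite normr_eq0 subr_eq0 => /(_ (normr_ge0 _))/eqP.
Qed.

Lemma warped_resolvent_singleton {R : realType} {X : normedModType R}
  (A : X -> set (dual X)) (D : set X) (W : D -> dual X) (x : D) (u : dual X)
  (gamma : R) : 0 < gamma ->
  let M := sv_add (sv_of W) (sv_scale gamma A) in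
  sv_injective M -> sv_ran M (W x + gamma *: u) ->
  exists z : D,
    warped_resolvent (sv_of W) (sv_scale gamma (sv_shift A u)) (val x) = [set val z]
    /\ (haraux A (val x) u >=
         (pairing (val x - val z) (W x - W z) / gamma)%:E)%E.
Proof.
move=> g0 M Minj [_ _ [_ [z <- <-] [_ [a Aa <-] eqz]]]; exists z; split.
  apply/seteqP; split=> [y|_ ->].
    move=> [_ [d /val_inj -> <-]].
    move=> [w Ww [_ [_ [b Ab <-] <-] eqy]].
    apply: Minj; exists (W x + gamma *: u); split; last first.
      by rewrite -eqz; exists (W z); [exists z | exists (gamma *: a) => //; exists a].
    exists w => //; exists (gamma *: b); first by exists b.
    by rewrite -eqy scalerBr addrA subrK.
  exists (W x); first by exists x.
  exists (W z); first by exists z.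
  exists (gamma *: (a - u)); first by exists (a - u) => //; exists a.
  by rewrite scalerBr addrA eqz addrK.
have -> : W x - W z = gamma *: (a - u).
  by rewrite scalerBr -[gamma *: a](addKr (W z)) eqz addrA addrK addrC.
rewrite {1}/pairing dualZ mulrAC divff ?gt_eqF// mul1r.
by apply: ereal_sup_ubound; exists (val z, a).
Qed.

Theorem theorem5p7 (R : realType) (X : completeNormedModType R)
    (X_neq0 : exists x : X, x != 0) (X_reflexive : reflexive_space X)
    (A : X -> set (dual X)) (D : set X) (D_neq0 : D !=set0)
    (W : D -> dual X) (x : D) (u : dual X) (gamma : R) (gamma_gt0 : 0 < gamma)
    (D_domA : D `&` sv_dom A !=set0) :
  let Wop : X -> set (dual X) := sv_of W in
  let M : X -> set (dual X) := sv_add Wop (sv_scale gamma A) in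
  (* (E1) *)
  (sv_ran M (W x + gamma *: u)
  (* (E2) *)
  \/ sv_surjective M
  (* (E3) *)
  \/ (maximally_monotone M /\ forall v, locally_bounded_at (sv_inv M) v)
  (* (E4) *)
  \/ (maximally_monotone M /\
       (bounded_set (sv_dom Wop `&` sv_dom A)
        \/ (~ bounded_set (sv_dom Wop `&` sv_dom A) /\
            forall m : R, exists r : R, forall y,
              (sv_dom Wop `&` sv_dom A) y -> r < `|y| ->
              (m%:E < ereal_inf [set `|v|%:E | v in M y])%E)))
  (* (E5) *)
  \/ (maximally_monotone M /\
       exists phi : R -> \bar R, phi_uniformly_monotone phi M /\
         (phi t * (t^-1)%:E)%E @[t --> +oo%R] --> +oo%E)
  (* (E6) *)
  \/ (maximally_monotone M /\ exists alpha : R, strongly_monotone alpha M)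
  (* (E7) *)
  \/ [/\ sv_monotone Wop, sv_monotone A, maximally_monotone M,
          [set v + gamma *: w | v in sv_ran Wop & w in sv_ran A] = setT
        & (three_star_monotone Wop /\ three_star_monotone A)
          \/ (three_star_monotone Wop /\ sv_dom A `<=` sv_dom Wop)
          \/ (three_star_monotone A /\ sv_dom Wop `<=` sv_dom A)]
  (* (E8) *)
  \/ (exists f : X -> \bar R,
       [/\ Gamma0 f, Wop = subdifferential f, sv_monotone A,
           maximally_monotone (sv_add (subdifferential f) (sv_scale gamma A))
         & [set v + gamma *: w | v in sv_dom (subdifferential (conjugate f))
                               & w in sv_ran A] = setT
           /\ (sv_dom A `<=` sv_dom (subdifferential f) \/ three_star_monotone A)])
  (* (E9) *)
  \/ [/\ sv_monotone Wop, sv_monotone A, maximally_monotone M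
        & (three_star_monotone Wop /\ sv_surjective Wop)
          \/ (three_star_monotone A /\ sv_surjective A)]) ->
  (* (i), (ii), (iii) *)
  (sv_injective M
  \/ strictly_monotone M
  \/ (uniformly_monotone Wop /\ sv_monotone A)) ->
  exists z : D,
    warped_resolvent Wop (sv_scale gamma (sv_shift A u)) (val x) = [set val z]
    /\ (haraux A (val x) u >=
         (pairing (val x - val z) (W x - W z) / gamma)%:E)%E.
Proof.
move=> Wop M range_hyp inj_hyp.
have Minj : sv_injective M.
  case: inj_hyp => [//|[/strictly_monotone_injective//|[Wu Am]]].
  exact: uniformly_monotone_sum_injective.
apply: warped_resolvent_singleton => //.
suff [//|->//] : sv_ran M (W x + gamma *: u) \/ sv_surjective M.
have [x0 [Dx0 [a0 Aa0]]] := D_domA.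
have [w0 W0] : sv_dom Wop x0.
  by exists (W (SigSub (mem_set Dx0))), (SigSub (mem_set Dx0)).
have dom0 : sv_dom Wop x0 by exists w0.
have monoM := @monotone_haraux_lty R X.
case: range_hyp => [|right_hyp]; [by left | right].
case: right_hyp => [//|[[Mm Mb]|]].
  exact: locally_bounded_inv_surjective.
move=> [[Mm Mc]|].
  apply: coercive_surjective => // m.
  have domM y v : M y v -> (sv_dom Wop `&` sv_dom A) y.
    by move=> [w Ww [_ [a Aa _] _]]; split; [exists w | exists a].
  case: Mc => [/bounded_setP[C CP]|[_ Mc]].
    by exists C => y v /domM /CP.
  have [r rP] := Mc m; exists r => y v Myv vm; rewrite leNgt; apply/negP => ry.
  have : (ereal_inf [set `|v|%:E | v in M y] <= m%:E)%E.
    by apply: (@le_trans _ _ `|v|%:E); [apply: ereal_inf_lbound; exists v | rewrite lee_fin].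
  by rewrite leNgt rP//; exact: domM Myv.
move=> [[Mm [phi [Mphi phioo]]]|].
  apply: coercive_surjective => //; apply: (superlinear_coercive Mm Mphi) => m.
  have /cvgeyPgt/(_ m)[T [_ TP]] := phioo; by exists T.
move=> [[Mm [alpha [alpha_gt0 Malpha]]]|].
  apply: coercive_surjective => //; apply: (superlinear_coercive Mm Malpha).
  exact: strongly_monotone_superlinear.
move=> [[Wm Am Mm ranT cases]|].
  apply: sum_surjective => // v.
  have : [set: dual X] v by [].
  rewrite -ranT => -[w Ww [a Aa <-]].
  case: cases => [[[_ W3] [_ A3]]|[[[_ W3] domAW]|[[_ A3] domWA]]].
  - by exists x0, w, a; split => //; [apply: W3 | apply: A3 => //; exists a0].
  - have [y _ Aya] := Aa; exists y, w, a; split => //; last exact: monoM.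
    by apply: W3 => //; apply: domAW; exists a.
  - have [y _ Wyw] := Ww; exists y, w, a; split => //; first exact: monoM.
    by apply: A3 => //; apply: domWA; exists w.
move=> [[f [[fNy fp _ _] WE Am Mm [ranT cases]]]|].
  rewrite /M WE; apply: sum_surjective => // v.
  have : [set: dual X] v by [].
  rewrite -ranT => -[w Ww [a Aa <-]].
  have fw : conjugate f w \is a fin_num.
    by apply: conjugate_fin_num => //; exists x0; rewrite -WE.
  have Hf y : sv_dom (subdifferential f) y -> (haraux (subdifferential f) y w < +oo)%E.
    move=> domy; apply: subdifferential_haraux_lty => //.
    exact: subdifferential_dom_fin_num.
  case: cases => [domAf|[_ A3]].
    have [y _ Aya] := Aa; exists y, w, a; split => //; last exact: monoM.
    by apply: Hf; apply: domAf; exists a.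
  exists x0, w, a; split => //; first by apply: Hf; rewrite -WE.
  by apply: A3 => //; exists a0.
move=> [Wm Am Mm cases]; apply: sum_surjective => // v.
case: cases => [[[_ W3] Ws]|[[_ A3] As]].
  exists x0, (v - gamma *: a0), a0; rewrite subrK; split => //; last exact: monoM.
  by apply: W3 => //; rewrite [X in X _]Ws.
exists x0, w0, (gamma^-1 *: (v - w0)); split; last 2 first.
- exact: monoM W0.
- by apply: A3; [exists a0 | rewrite [X in X _]As].
- by rewrite scalerA divff ?gt_eqF// scale1r addrC subrK.
Qed.
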